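(* Let $A\in\mathbf{R}^{n\times n}$ be symmetric positive definite, $b\in\mathbf{R}^n$, let $P^{-1}\in\mathbf{R}^{n\times n}$ be nonsingular, and fix $\ell\in\{0,\tfrac12,1,\tfrac32,2,\tfrac52,3,\dots\}$. Given $x_0\in\mathbf{R}^n$, for all $k\ge 0$ let $1\le m_k\le n$ and let the iterates be $$x_{k+1}=x_k-P^{-1}W_k a_k,$$ where $W_k\in\mathbf{R}^{n\times m_k}$ has full rank (i.e. linearly independent columns) and its column space contains $g(z_k)=Az_k-b$ with $z_k=P^{-T}x_k$, and where $$a_k := \left(W_k^T P^{-T}\tilde A^{2\ell+1}P^{-1}W_k\right)^{-1}W_k^TP^{-T}\tilde A^{2\ell}\tilde g_k .$$ Then $$a_k=\arg\min_{a\in\mathbf{R}^{m_k}}\ \|\tilde g_{k+1}\|^2_{\tilde A^{2\ell-1}},$$ where on the right-hand side $\tilde g_{k+1}$ is regarded as a function of $a$, namely the preconditioned gradient at the point $x_k-P^{-1}W_k a$.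
   Context: The problem is to minimize $f(z)=\tfrac12 z^TAz-z^Tb$ over $z\in\mathbf{R}^n$. The gradient is $g(z)=\nabla f(z)=Az-b$. Preconditioned quantities: $P$ is the inverse of $P^{-1}$, $P^{-T}=(P^{-1})^T$, $\tilde A=P^{-1}AP^{-T}$ (symmetric positive definite), $\tilde b=P^{-1}b$, variables are related by $z=P^{-T}x$, and the preconditioned gradient at $x_k$ is $\tilde g_k=P^{-1}(AP^{-T}x_k-b)=\tilde A x_k-\tilde b=P^{-1}g(z_k)$. For a symmetric positive definite matrix $B$, $\|v\|_B=\sqrt{v^TBv}$. Since $2\ell$ is a nonnegative integer, all powers of $\tilde A$ are integer powers, with $\tilde A^0=I$. *)

(* Defs.v *)
From HB Require Import structures.
From mathcomp Require Export all_boot all_order all_algebra.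
From mathcomp Require Export classical_sets reals.

Set Implicit Arguments.
Unset Strict Implicit.
Unset Printing Implicit Defensive.

Import Order.TTheory GRing.Theory Num.Theory.
Local Open Scope ring_scope.

Definition sympd (R : realType) (n : nat) (B : 'M[R]_n) : Prop :=
  B \is symmetricmx /\ forall v : 'cV[R]_n, v != 0 -> 0 < (v^T *m B *m v) 0 0.

(* [^] with an integer exponent would need a [unitRingType], which 'M_n is only
   for n of the form n'.+1. *)
Definition mxexpz (R : realType) (n : nat) (B : 'M[R]_n) (z : int) : 'M[R]_n :=
  match z with
  | Posz k => B ^+ k
  | Negz k => invmx (B ^+ k.+1)
  end.

(* ||v||_B; a norm only when B is symmetric positive definite. *)
Definition mxnorm (R : realType) (n : nat) (B : 'M[R]_n) (v : 'cV[R]_n) : R :=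
  Num.sqrt ((v^T *m B *m v) 0 0).

(* The set of all global minimizers: [argmin f = [set a]%classic] says that a
   is the unique one. *)
Definition argmin (R : realType) (T : Type) (f : T -> R) : set T :=
  [set a | forall a', f a <= f a']%classic.

(* Gradient of z |-> 1/2 z^T A z - z^T b for symmetric A. *)
Definition grad (R : realType) (n : nat) (A : 'M[R]_n) (b z : 'cV[R]_n) :
    'cV[R]_n :=
  A *m z - b.

(* Below, Pinv stands for P^-1: it is the given matrix, and P = invmx Pinv. *)
Definition unprec (R : realType) (n : nat) (Pinv : 'M[R]_n) (x : 'cV[R]_n) :
    'cV[R]_n :=
  Pinv^T *m x.

Definition precmx (R : realType) (n : nat) (A Pinv : 'M[R]_n) : 'M[R]_n :=
  Pinv *m A *m Pinv^T.

Definition precgrad (R : realType) (n : nat) (A Pinv : 'M[R]_n)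
    (b x : 'cV[R]_n) : 'cV[R]_n :=
  Pinv *m grad A b (unprec Pinv x).

(* (W^T P^-T At^(2l+1) P^-1 W)^-1 W^T P^-T At^(2l) gt, where twol = 2l. *)
Definition stepcoef (R : realType) (n : nat) (A Pinv : 'M[R]_n)
    (b : 'cV[R]_n) (twol m : nat) (W : 'M[R]_(n, m)) (x : 'cV[R]_n) :
    'cV[R]_m :=
  let At := precmx A Pinv in
  invmx (W^T *m Pinv^T *m At ^+ twol.+1 *m Pinv *m W)
    *m (W^T *m Pinv^T *m At ^+ twol *m precgrad A Pinv b x).

(* Main.v *)
Require Import Defs.

Set Implicit Arguments.
Unset Strict Implicit.
Unset Printing Implicit Defensive.

Import Order.TTheory GRing.Theory Num.Theory.
Local Open Scope ring_scope.

(** Only one iteration matters, so the index [k] is fixed.  Write B for the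
    preconditioned matrix, V = P^-1 W and g for the preconditioned gradient at
    the current iterate.  A step from there along - V a changes the
    preconditioned gradient to g - B V a, which is affine in a
    ([precgrad_step]).  Minimizing its squared norm in the weight
    C = B^(2l-1) is therefore a weighted linear least squares problem with
    design matrix F = B V.  As C is positive definite and F has independent
    columns, completing the square ([sqnorm_residual]) shows that the unique
    minimizer is the solution (F^T C F)^-1 F^T C g of the normal equations
    ([argmin_least_squares]).  Since B C = B^(2l), also when 2l = 0 and C is
    the inverse of B, F^T C F = V^T B^(2l+1) V and F^T C g = V^T B^(2l) g: this is
    the formula defining a_k.

    Positive definiteness spreads from A and the identity to B, its powers,
    its inverse and F^T C F by one principle, invariance under congruence by a
    matrix with independent columns ([sympd_congr]). *)

Section PositiveDefinite.
Variable R : realType.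

Lemma symmetricE n (B : 'M[R]_n) : (B \is symmetricmx) = (B^T == B).
Proof. by rewrite is_hermitianmxE expr0 scale1r map_mx_id // eq_sym. Qed.

Lemma sympd_tr n (B : 'M[R]_n) : sympd B -> B^T = B.
Proof. by case=> + _; rewrite symmetricE => /eqP. Qed.

Lemma sympd_gt0 n (B : 'M[R]_n) (v : 'cV[R]_n) :
  sympd B -> v != 0 -> 0 < (v^T *m B *m v) 0 0.
Proof. by case=> _; apply. Qed.

Lemma sympd_ge0 n (B : 'M[R]_n) (v : 'cV[R]_n) :
  sympd B -> 0 <= (v^T *m B *m v) 0 0.
Proof.
move=> hB; have [->|v0] := eqVneq v 0; first by rewrite mulmx0 mxE.
exact/ltW/sympd_gt0.
Qed.

Lemma col_free_inj n m (V : 'M[R]_(n, m)) (v : 'cV[R]_m) :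
  row_free V^T -> v != 0 -> V *m v != 0.
Proof.
move=> fV; apply: contra_neq => Vv0.
by apply/trmx_inj/(row_free_inj fV); rewrite -trmx_mul Vv0 !trmx0 mul0mx.
Qed.

Lemma sympd_congr n m (B : 'M[R]_n) (V : 'M[R]_(n, m)) :
  sympd B -> row_free V^T -> sympd (V^T *m B *m V).
Proof.
move=> hB fV; split.
  by rewrite symmetricE !trmx_mul trmxK (sympd_tr hB) mulmxA.
move=> v v0; have := sympd_gt0 hB (col_free_inj fV v0).
by rewrite trmx_mul !mulmxA.
Qed.

Lemma sympd1 n : sympd (1%:M : 'M[R]_n).
Proof.
split; first by rewrite symmetricE trmx1.
move=> v v0; rewrite mulmx1 mxE.
have [i vi0] : exists i, v i 0 != 0.
  apply/existsP; apply: contra_neqT v0 => /existsPn v0.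
  by apply/colP => i; rewrite mxE; apply/eqP; have := v0 i; rewrite negbK.
rewrite (bigD1 i) //= mxE ltr_pwDl // -?expr2.
  by rewrite lt_def sqrf_eq0 vi0 sqr_ge0.
by apply: sumr_ge0 => j _; rewrite mxE -expr2 sqr_ge0.
Qed.

Lemma sympd_unitmx n (B : 'M[R]_n) : sympd B -> B \in unitmx.
Proof.
move=> hB; rewrite -row_free_unit -kermx_eq0.
apply/rowV0P => u /sub_kermxP uB0; apply/eqP/negPn/negP => u0.
have := @sympd_gt0 _ _ u^T hB; rewrite trmxK uB0 mul0mx mxE ltxx => /(_ _)/negP.
by apply=> //; rewrite -trmx0 (inj_eq trmx_inj).
Qed.

Lemma row_free_tr_unitmx n (B : 'M[R]_n) : B \in unitmx -> row_free B^T.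
Proof. by rewrite row_free_unit unitmx_tr. Qed.

(** The inverse is congruent to B itself: B^-1 = (B^-1)^T B B^-1. *)
Lemma sympd_inv n (B : 'M[R]_n) : sympd B -> sympd (invmx B).
Proof.
move=> hB; have uB := sympd_unitmx hB.
suff -> : invmx B = (invmx B)^T *m B *m invmx B.
  by apply: sympd_congr => //; apply: row_free_tr_unitmx; rewrite unitmx_inv.
by rewrite trmx_inv (sympd_tr hB) mulVmx // mul1mx.
Qed.

(** Congruence by B raises the exponent by two, so even powers come from the
    identity and odd ones from B itself. *)
Lemma sympd_exp n (B : 'M[R]_n) k : sympd B -> sympd (B ^+ k).
Proof.
move=> hB; suff [] : sympd (B ^+ k) /\ sympd (B ^+ k.+1) by [].
elim: k => [|k [hk hk1]]; first by split; [exact: sympd1|].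
split=> //; rewrite exprSr exprS.
have := sympd_congr hk (row_free_tr_unitmx (sympd_unitmx hB)).
by rewrite (sympd_tr hB).
Qed.

Lemma sympd_expz n (B : 'M[R]_n) z : sympd B -> sympd (mxexpz B z).
Proof.
case: z => k hB /=; first exact: sympd_exp.
exact/sympd_inv/sympd_exp.
Qed.

Lemma mulmx_expz_pred n (B : 'M[R]_n) k :
  sympd B -> B *m mxexpz B (Posz k - 1) = B ^+ k.
Proof.
move=> hB; case: k => [|k].
  by rewrite /= expr1 mulmxV //; exact: sympd_unitmx.
have -> : Posz k.+1 - 1 = Posz k by rewrite intS addrC addKr.
by rewrite /= exprS.
Qed.

End PositiveDefinite.

Section LeastSquares.
Variables (R : realType) (n m : nat) (C : 'M[R]_n) (F : 'M[R]_(n, m)).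
Variable g : 'cV[R]_n.
Hypotheses (hC : sympd C) (fF : row_free F^T).

Let M := F^T *m C *m F.
Let best := invmx M *m (F^T *m C *m g).

Let unitM : M \in unitmx.
Proof. exact/sympd_unitmx/sympd_congr. Qed.

Lemma mxnorm_sqr (v : 'cV[R]_n) : mxnorm C v ^+ 2 = (v^T *m C *m v) 0 0.
Proof. by rewrite sqr_sqrtr // sympd_ge0. Qed.

(** The normal equations make the residual at [best] orthogonal, for the
    weight C, to the column space of F. *)
Lemma normal_equations : F^T *m C *m (g - F *m best) = 0.
Proof. by rewrite mulmxBr mulmxA -/M mulKVmx // subrr. Qed.

(** Pythagoras: the cross terms vanish by [normal_equations]. *)
Lemma sqnorm_residual (a : 'cV[R]_m) :
  mxnorm C (g - F *m a) ^+ 2 =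
  mxnorm C (g - F *m best) ^+ 2 + ((a - best)^T *m M *m (a - best)) 0 0.
Proof.
rewrite !mxnorm_sqr.
set r := g - F *m best; set d := a - best.
have -> : g - F *m a = r - F *m d.
  by rewrite /r -addrA -opprD -mulmxDr [best + d]addrC subrK.
have FCr : F^T *m C *m r = 0 := normal_equations.
have rCF : r^T *m C *m F = 0.
  by apply: trmx_inj; rewrite !trmx_mul trmxK (sympd_tr hC) mulmxA FCr !trmx0.
clearbody r d.
have -> : (r - F *m d)^T *m C *m (r - F *m d) =
    r^T *m C *m r + d^T *m M *m d.
  rewrite [(r - _)^T]linearB /= trmx_mul !(mulmxBl, mulmxBr) /M !mulmxA.
  rewrite rCF mul0mx -(mulmxA d^T) -(mulmxA d^T _ r) FCr mulmx0.
  by rewrite !(subr0, sub0r) opprK !mulmxA.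
by rewrite mxE.
Qed.

Lemma argmin_least_squares :
  argmin (fun a => mxnorm C (g - F *m a) ^+ 2) = [set best]%classic.
Proof.
have hM : sympd M by exact: sympd_congr.
apply/seteqP; split => [a /= mina | _ -> a /=].
  apply/eqP; rewrite -subr_eq0; apply: contraT => d0.
  have := mina best.
  by rewrite sqnorm_residual gerDl leNgt sympd_gt0.
by rewrite [leRHS]sqnorm_residual lerDl sympd_ge0.
Qed.

End LeastSquares.

Lemma precgrad_step (R : realType) n m (A Pinv : 'M[R]_n) (b x : 'cV[R]_n)
    (W : 'M[R]_(n, m)) (a : 'cV[R]_m) :
  precgrad A Pinv b (x - Pinv *m W *m a) =
  precgrad A Pinv b x - precmx A Pinv *m (Pinv *m W) *m a.
Proof.
rewrite /precgrad /grad /unprec /precmx !(mulmxBr, mulmxA).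
by rewrite addrAC.
Qed.

(* twol is 2l: l ranges over {0, 1/2, 1, 3/2, ...}. *)
Theorem lemma6 (R : realType) (n : nat) (A : 'M[R]_n) (b : 'cV[R]_n)
  (Pinv : 'M[R]_n) (twol : nat)
  (x : nat -> 'cV[R]_n) (m : nat -> nat)
  (W : forall k : nat, 'M[R]_(n, m k)) (a : forall k : nat, 'cV[R]_(m k))
  (hA : sympd A)
  (hP : Pinv \in unitmx)
  (hm : forall k : nat, (1 <= m k <= n)%N)
  (hWrank : forall k : nat, \rank (W k) = m k)
  (hWgrad : forall k : nat,
     exists y : 'cV[R]_(m k), W k *m y = grad A b (unprec Pinv (x k)))
  (ha : forall k : nat, a k = stepcoef A Pinv b twol (W k) (x k))
  (hx : forall k : nat, x k.+1 = x k - Pinv *m W k *m a k) :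
  forall k : nat,
    argmin (fun a' : 'cV[R]_(m k) =>
      mxnorm (mxexpz (precmx A Pinv) (Posz twol - 1))
             (precgrad A Pinv b (x k - Pinv *m W k *m a')) ^+ 2)
    = [set a k]%classic.
Proof.
move=> k.
set B := precmx A Pinv; set C := mxexpz B _; set V := Pinv *m W k.
have hB : sympd B.
  have := @sympd_congr _ _ _ _ Pinv^T hA; rewrite trmxK; apply.
  by rewrite row_free_unit.
have hC : sympd C by exact: sympd_expz.
have fF : row_free (B *m V)^T.
  rewrite trmx_mul /row_free mxrankMfree; last first.
    exact/row_free_tr_unitmx/sympd_unitmx.
  by rewrite trmx_mul mxrankMfree ?row_free_tr_unitmx // mxrank_tr hWrank.
have BC : B *m C = B ^+ twol by exact: mulmx_expz_pred.
have FtC : (B *m V)^T *m C = (W k)^T *m Pinv^T *m B ^+ twol.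
  by rewrite trmx_mul (sympd_tr hB) trmx_mul -[LHS]mulmxA BC.
have FtCF : (B *m V)^T *m C *m (B *m V) =
    (W k)^T *m Pinv^T *m B ^+ twol.+1 *m Pinv *m W k.
  by rewrite FtC exprSr !mulmxA.
rewrite ha /stepcoef -/B -FtC -FtCF -argmin_least_squares //.
by congr argmin; apply: boolp.funext => a'; rewrite precgrad_step.
Qed.
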